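(* Let $\ell\in\mathbb{Z}$ and $m\in\{0,1,2,\ldots\}$ with $m\ge\ell$. For all $x\in\mathbb{R}$, $$J_1\!\left(\frac{\ell}{2},\,m+\frac{1-\ell}{2};\,x\right)=e^{x}\,\mathcal{F}(-\ell,m-\ell,-x)+\mathcal{F}(\ell,m,x).$$
   Context: $J_1(\kappa,\mu;x)=\int_0^1 e^{xt}t^{\mu-\kappa-1/2}(1-t)^{\mu+\kappa-1/2}\ln\left[t(1-t)\right]dt$, so that here $J_1\!\left(\frac{\ell}{2},m+\frac{1-\ell}{2};x\right)=\int_0^1 e^{xt}t^{m-\ell}(1-t)^{m}\ln\left[t(1-t)\right]dt$. For integers $s,k$ with $k\ge0$ and $k\ge s$, $$\mathcal{F}(s,k,z)=\sum_{n=0}^{k}(-1)^n\binom{k}{n}\frac{d^{\,n+k-s}}{dz^{\,n+k-s}}\left[\frac{\ln z-\mathrm{Chi}(z)-\mathrm{Shi}(z)+\gamma}{z}\right],$$ where $\gamma$ is Euler's constant, $\mathrm{Shi}(z)=\int_0^z\frac{\sinh t}{t}dt$ and $\mathrm{Chi}(z)=\gamma+\ln z+\int_0^z\frac{\cosh t-1}{t}dt$ (same branch of $\ln z$ in both places). The bracketed function extends to an entire function of $z$, and $\mathcal{F}(s,k,0)$ is understood through this extension. *)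

(* Defs.v *)
From Stdlib Require Import Reals ZArith.
From Coquelicot Require Import Coquelicot.
Open Scope R_scope.

(* On 0 < t < 1 the powers with real exponents are [Rpower]. *)
Definition J1_integrand (kappa mu x t : R) : R :=
  exp (x * t) * Rpower t (mu - kappa - 1 / 2)
    * Rpower (1 - t) (mu + kappa - 1 / 2) * ln (t * (1 - t)).

(* The integrand may be unbounded at 0 and at 1, so the integral is improper
   at both endpoints. *)
Definition J1_converges (kappa mu x : R) : Prop :=
  ex_RInt_gen (J1_integrand kappa mu x) (at_right 0) (at_left 1).

Definition J1 (kappa mu x : R) : R :=
  RInt_gen (J1_integrand kappa mu x) (at_right 0) (at_left 1).

Definition Euler_gamma : R :=
  real (Lim_seq (fun n : nat =>
    sum_f_R0 (fun j : nat => / INR (S j)) n - ln (INR (S n)))).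

Definition Cexp (z : C) : C :=
  (exp (Re z) * cos (Im z), exp (Re z) * sin (Im z)).
Definition Csinh (z : C) : C := ((Cexp z - Cexp (- z)) / 2)%C.
Definition Ccosh (z : C) : C := ((Cexp z + Cexp (- z)) / 2)%C.

(* A choice of a logarithm at every nonzero point; no continuity is required,
   so every branch of the logarithm, with any cut, is covered. *)
Definition is_clog (clog : C -> C) : Prop :=
  forall z : C, z <> 0 -> Cexp (clog z) = z.

(* Integral of f from 0 to z along the segment u |-> u z, 0 <= u <= 1. The
   integrands used below have a removable singularity at 0; their value there,
   the endpoint u = 0, does not affect the integral. *)
Definition C_int0 (f : C -> C) (z : C) : C :=
  RInt (V := C_R_CompleteNormedModule)
    (fun u : R => (f (u * z) * z)%C) 0 1.

Definition Shi (z : C) : C := C_int0 (fun t => Csinh t / t)%C z.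
Definition Chi (clog : C -> C) (z : C) : C :=
  (Euler_gamma + clog z + C_int0 (fun t => (Ccosh t - 1) / t) z)%C.

Definition bracket (clog : C -> C) (z : C) : C :=
  ((clog z - Chi clog z - Shi z + Euler_gamma) / z)%C.

(* [bracket] is given by its formula at every z <> 0, for any choice of
   logarithm, and its singularity at 0 is removable. *)
Definition bracket_ext (clog : C -> C) (z : C) : C :=
  if Ceq_dec z 0 then C_lim (bracket clog) 0 else bracket clog z.

Definition C_derive_n (f : C -> C) (n : nat) : C -> C :=
  Nat.iter n C_derive f.

(* Meant for k >= 0 and k >= s, where [Z.to_nat] truncates nothing.
   [Binomial.C] is the binomial coefficient; [C] is the field of complex
   numbers. *)
Definition calF (clog : C -> C) (s k : Z) (z : C) : C :=
  sum_n (fun n : nat =>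
    (RtoC ((-1) ^ n * Binomial.C (Z.to_nat k) n)
     * C_derive_n (bracket_ext clog) (Z.to_nat (Z.of_nat n + k - s)) z)%C)
    (Z.to_nat k).

(* Main.v *)
(* The logarithms in the bracket cancel, and the bracket is the entire function
   g(z) = - sum_n z^n / (n! (n+1)^2) = int_0^1 e^(z t) ln t dt. Its j-th
   derivative is int_0^1 t^j e^(z t) ln t dt, and t^j e^(x t) ln t has an explicit
   primitive on (0,1), built from the series sum_n y^n / (n! (n+j+1)^p), p = 1, 2.
   Split ln (t (1 - t)) = ln t + ln (1 - t): expanding (1 - t)^m in the first part
   gives F(l, m, x), and t |-> 1 - t turns the second part into
   e^x F(-l, m - l, -x). *)
Require Import Defs.
From Stdlib Require Import Reals ZArith Lra Lia.
From Coquelicot Require Import Coquelicot.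
Open Scope R_scope.

(** * The entire functions [expint p j], their derivatives and recurrence *)

Definition expint_coef (p j n : nat) : R := / (INR (fact n) * INR (S (n + j)) ^ p).

(* For p > 0 this is the integral over 0 < t < 1 of
   t^j e^(y t) (- ln t)^(p-1) / (p-1)!. *)
Definition expint (p j : nat) (y : R) : R := PSeries (expint_coef p j) y.

Lemma expint_denom_pos (p j n : nat) : 0 < INR (fact n) * INR (S (n + j)) ^ p.
Proof.
  apply Rmult_lt_0_compat.
  - apply INR_fact_lt_0.
  - apply pow_lt, lt_0_INR; lia.
Qed.

(** Ratio test: the factor (n+j+1)^p / (n+j+2)^p is at most 1, so the ratio of consecutive
    coefficients is at most 1/(n+1). *)
Lemma expint_CV_radius (p j : nat) : CV_radius (expint_coef p j) = p_infty.
Proof.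
  apply CV_radius_infinite_DAlembert.
  - intros n; apply Rinv_neq_0_compat, Rgt_not_eq, expint_denom_pos.
  - apply is_lim_seq_le_le with (u := fun _ => 0) (w := fun n => / INR (S n)).
    + intros n; split; [apply Rabs_pos|].
      pose proof (expint_denom_pos p j n) as Hn.
      pose proof (expint_denom_pos p j (S n)) as HS.
      unfold expint_coef; rewrite Rabs_pos_eq.
      2: { unfold Rdiv; rewrite Rinv_inv.
           apply Rmult_le_pos; [left; apply Rinv_0_lt_compat|left]; assumption. }
      unfold Rdiv; rewrite Rinv_inv.
      assert (H0 : 0 < INR (S n)) by (apply lt_0_INR; lia).
      apply Rmult_le_reg_l with (INR (fact (S n)) * INR (S (S n + j)) ^ p); [exact HS|].
      rewrite <- Rmult_assoc, Rinv_r, Rmult_1_l by lra.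
      rewrite fact_simpl, mult_INR.
      replace (INR (S n) * INR (fact n) * INR (S (S n + j)) ^ p * / INR (S n))
        with (INR (fact n) * INR (S (S n + j)) ^ p) by (field; lra).
      apply Rmult_le_compat_l; [apply pos_INR|].
      apply pow_incr; split; [apply pos_INR|apply le_INR; lia].
    + apply is_lim_seq_const.
    + apply (is_lim_seq_incr_1 (fun n => / INR n)).
      replace (Finite 0) with (Rbar_inv p_infty) by reflexivity.
      apply is_lim_seq_inv; [apply is_lim_seq_INR|discriminate].
Qed.

Lemma expint_ex_pseries (p j : nat) (y : R) : ex_pseries (expint_coef p j) y.
Proof. apply CV_radius_inside; rewrite expint_CV_radius; exact I. Qed.

(** The factor n+1 from differentiation cancels against (n+1)!, and (n+1)+j = n+(j+1), so a
    derivative only shifts [j]. *)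
Lemma is_derive_expint (p j : nat) (y : R) :
  is_derive (expint p j) y (expint p (S j) y).
Proof.
  replace (expint p (S j) y) with (PSeries (PS_derive (expint_coef p j)) y).
  - apply is_derive_PSeries; rewrite expint_CV_radius; exact I.
  - apply PSeries_ext; intros n; unfold PS_derive, expint_coef.
    rewrite fact_simpl, mult_INR.
    replace (S n + j)%nat with (n + S j)%nat by lia.
    field; repeat split.
    + apply pow_nonzero, not_0_INR; lia.
    + apply INR_fact_neq_0.
    + apply not_0_INR; lia.
Qed.

(** Compare coefficients of y^n: the left side gives n + (j+1) over n! (n+j+1)^(p+1), and one factor
    n+j+1 cancels. For p > 0 this is integration by parts in the integral form of [expint]. *)
Lemma expint_rec (p j : nat) (y : R) :
  y * expint (S p) (S j) y + INR (S j) * expint (S p) j y = expint p j y.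
Proof.
  unfold expint.
  rewrite <- PSeries_incr_1, <- PSeries_scal, <- PSeries_plus.
  - apply PSeries_ext; intros n.
    change (PS_incr_1 (expint_coef (S p) (S j)) n
            + INR (S j) * expint_coef (S p) j n = expint_coef p j n).
    pose proof (INR_fact_neq_0 n) as Hfact.
    assert (Hj : INR (S (n + j)) <> 0) by (apply not_0_INR; lia).
    pose proof (pow_nonzero _ p Hj) as Hp.
    (* The constant coefficient is separate: multiplication by y puts a zero there. *)
    destruct n as [|n]; unfold PS_incr_1, expint_coef; rewrite <- !tech_pow_Rmult.
    + change (@zero R_NormedModule) with 0; simpl (0 + j)%nat in *; simpl fact in *.
      field; repeat split; assumption.
    + replace (S (n + S j)) with (S (S n + j)) by lia.
      rewrite fact_simpl, mult_INR in *.
      replace (INR (S (S n + j))) with (INR (S n) + INR (S j)) in *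
        by (rewrite <- plus_INR; f_equal; lia).
      field; repeat split; try assumption;
        intro H0; apply Hfact; rewrite H0; ring.
  - apply ex_pseries_incr_1, expint_ex_pseries.
  - apply ex_pseries_scal; [apply Rmult_comm|apply expint_ex_pseries].
Qed.

Lemma expint_0 (j : nat) (y : R) : expint 0 j y = exp y.
Proof.
  rewrite exp_Reals; apply PSeries_ext; intros n; unfold expint_coef.
  simpl pow; now rewrite Rmult_1_r.
Qed.

(** Identifies [expint 1 0] as the entire extension of (e^y - 1)/y; the product form avoids dividing
    at y = 0. *)
Lemma expint_1_0 (y : R) : y * expint 1 0 y = exp y - 1.
Proof.
  rewrite exp_Reals, PSeries_decr_1.
  - unfold expint, PS_decr_1; simpl (fact 0).
    rewrite (PSeries_ext (fun n => / INR (fact (S n))) (expint_coef 1 0)).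
    + simpl INR; rewrite Rinv_1; ring.
    + intros n; unfold expint_coef; rewrite fact_simpl, mult_INR, pow_1.
      now rewrite Nat.add_0_r, Rmult_comm.
  - exists (exp y); apply is_exp_Reals.
Qed.

(** By [expint_rec], raising [p] integrates: starting from t^j e^(x t) at p = 0, each primitive
    divided by t is again of the same shape. *)
Lemma is_derive_pow_expint (p j : nat) (x t : R) :
  is_derive (fun t => t ^ S j * expint (S p) j (x * t)) t (t ^ j * expint p j (x * t)).
Proof.
  rewrite <- (expint_rec p j (x * t)).
  replace (t ^ j * _) with
    (INR (S j) * 1 * t ^ pred (S j) * expint (S p) j (x * t)
     + t ^ S j * (x * expint (S p) (S j) (x * t)))
    by (simpl pred; rewrite <- tech_pow_Rmult; ring).
  apply (is_derive_mult (fun t => t ^ S j) (fun t => expint (S p) j (x * t))).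
  - apply is_derive_pow, (is_derive_id (K := R_AbsRing)).
  - apply (is_derive_comp (expint (S p) j) (fun t => x * t)).
    + apply is_derive_expint.
    + auto_derive; [exact I|ring].
  - intros; apply Rmult_comm.
Qed.

Lemma continuous_expint (p j : nat) (y : R) : continuous (expint p j) y.
Proof.
  apply (ex_derive_continuous (V := R_NormedModule)).
  eexists; apply is_derive_expint.
Qed.

(** * Complex limits, derivatives and segment integrals at real points *)

(* Coquelicot's [C_lim] is a limit along the horizontal line through the point, so
   at real points [C_lim] and [C_derive] see only the restriction to the reals. *)
Lemma C_lim_RtoC (f : C -> C) (g : R -> R) (x l : R) :
  (forall y : R, y <> x -> f y = g y) -> is_lim g x l -> C_lim f x = l.
Proof.
  intros Hfg Hg; unfold C_lim, RtoC; simpl.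
  assert (Hloc : forall P : R -> Prop, (forall y, y <> x -> P y) -> Rbar_locally' x P).
  { intros P HP; exists (mkposreal 1 Rlt_0_1); intros y _ Hy; apply HP, Hy. }
  f_equal.
  - rewrite (is_lim_unique _ x l); [reflexivity|].
    apply is_lim_ext_loc with (2 := Hg), Hloc; intros y Hy.
    change (g y = fst (f (RtoC y))); now rewrite (Hfg y Hy).
  - rewrite (is_lim_unique _ x 0); [reflexivity|].
    apply is_lim_ext_loc with (f := fun _ => 0); [|apply is_lim_const].
    apply Hloc; intros y Hy.
    change (0 = snd (f (RtoC y))); now rewrite (Hfg y Hy).
Qed.

Lemma C_derive_RtoC (f : C -> C) (g : R -> R) (x l : R) :
  (forall y : R, f y = g y) -> is_derive g x l -> C_derive f x = l.
Proof.
  intros Hfg Hg; unfold C_derive.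
  apply C_lim_RtoC with (g := fun y => (g y - g x) / (y - x)).
  - intros y Hy; rewrite !Hfg, <- !RtoC_minus, <- RtoC_div; [reflexivity|lra].
  - apply is_derive_Reals in Hg.
    apply is_lim_spec; intros eps.
    destruct (Hg eps (cond_pos eps)) as [d Hd].
    exists d; intros y Hy Hyx.
    specialize (Hd (y - x)); rewrite Rplus_minus in Hd.
    apply Hd; [apply Rminus_eq_contra, Hyx|exact Hy].
Qed.

Lemma Cexp_RtoC (x : R) : Cexp x = exp x.
Proof.
  unfold Cexp, RtoC; simpl; now rewrite cos_0, sin_0, Rmult_1_r, Rmult_0_r.
Qed.

(** At u = 0 a quotient such as sinh t / t takes a default value, so agreement is asked only inside
    the interval. *)
Lemma C_int0_RtoC (f : C -> C) (g : R -> R) (x v : R) :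
  (forall u, 0 < u < 1 -> f (RtoC (u * x)) = g (u * x)) ->
  is_RInt (fun u => g (u * x) * x) 0 1 v -> C_int0 f x = v.
Proof.
  intros Hfg Hg; unfold C_int0.
  apply (is_RInt_unique (V := C_R_CompleteNormedModule)).
  apply (is_RInt_ext (V := C_R_NormedModule)) with (f := fun u => RtoC (g (u * x) * x)).
  - rewrite Rmin_left, Rmax_right by lra; intros u Hu.
    now rewrite <- RtoC_mult, (Hfg u Hu), <- RtoC_mult.
  - apply (is_RInt_fct_extend_pair (U := R_NormedModule) (V := R_NormedModule)).
    + exact Hg.
    (* The imaginary part is the integral of 0, which the constant rule delivers as (1 - 0) * 0. *)
    + pose proof (is_RInt_const (V := R_NormedModule) 0 1 0) as H0.
      apply (eq_ind _ (is_RInt (fun _ : R => 0) 0 1) H0), Rmult_0_r.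
Qed.

(** * Shi, Chi, the bracket and its derivatives on the real line *)

Lemma is_RInt_expint_1_0 (x : R) :
  is_RInt (fun u => expint 1 0 (u * x) * x) 0 1 (x * expint 2 0 x).
Proof.
  (* The primitive is x u [expint 2 0] (x u), the case p = 1, j = 0 of [is_derive_pow_expint]; it
     vanishes at u = 0. *)
  replace (x * expint 2 0 x) with
    (minus (x * (1 ^ 1 * expint 2 0 (x * 1))) (x * (0 ^ 1 * expint 2 0 (x * 0)))).
  2: { unfold minus, plus, opp; simpl; rewrite !Rmult_1_r; ring. }
  apply (is_RInt_derive (fun t => x * (t ^ 1 * expint 2 0 (x * t)))
           (fun t => expint 1 0 (t * x) * x)).
  - intros u _.
    replace (expint 1 0 (u * x) * x) with (x * (u ^ 0 * expint 1 0 (x * u)))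
      by (simpl; rewrite (Rmult_comm u x); ring).
    apply is_derive_scal, is_derive_pow_expint.
  - intros u _; apply (continuous_mult (fun t => expint 1 0 (t * x)) (fun _ => x)).
    + apply continuous_comp; [|apply continuous_expint].
      apply (continuous_mult (fun t => t) (fun _ => x));
        [apply continuous_id|apply continuous_const].
    + apply continuous_const.
Qed.

Lemma is_RInt_expint_1_0_opp (x : R) :
  is_RInt (fun u => expint 1 0 (- (u * x)) * x) 0 1 (x * expint 2 0 (- x)).
Proof.
  replace (x * expint 2 0 (- x)) with (opp (- x * expint 2 0 (- x)))
    by (unfold opp; simpl; ring).
  apply is_RInt_ext with (f := fun u => opp (expint 1 0 (u * - x) * - x)).
  - intros u _; unfold opp; simpl; replace (u * - x) with (- (u * x)) by ring; ring.
  - apply (is_RInt_opp (V := R_NormedModule)), is_RInt_expint_1_0.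
Qed.

(** With h(y) = (e^y - 1)/y, sinh y / y is the even part (h(y) + h(-y))/2 of h. *)
Lemma Shi_RtoC (x : R) :
  x <> 0 -> Shi x = RtoC (x * (expint 2 0 x + expint 2 0 (- x)) / 2).
Proof.
  intros Hx.
  apply C_int0_RtoC with (g := fun y => (expint 1 0 y + expint 1 0 (- y)) / 2).
  - intros u Hu; set (y := u * x).
    assert (Hy : y <> 0) by (apply Rmult_integral_contrapositive; lra).
    unfold Csinh; rewrite <- RtoC_opp, !Cexp_RtoC, <- RtoC_minus.
    rewrite <- !RtoC_div by (lra || exact Hy); f_equal.
    pose proof (expint_1_0 y) as H1; pose proof (expint_1_0 (- y)) as H2.
    apply Rmult_eq_reg_l with y; [|exact Hy].
    field_simplify; [|exact Hy]; lra.
  - apply is_RInt_ext with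
      (f := fun u => scal (/ 2) (plus (expint 1 0 (u * x) * x) (expint 1 0 (- (u * x)) * x))).
    + intros u _; unfold scal, plus; simpl; unfold mult; simpl; field.
    + replace (x * _ / 2) with
        (scal (/ 2) (plus (x * expint 2 0 x) (x * expint 2 0 (- x))))
        by (unfold scal, plus; simpl; unfold mult; simpl; field).
      apply (is_RInt_scal (V := R_NormedModule)), (is_RInt_plus (V := R_NormedModule));
        [apply is_RInt_expint_1_0|apply is_RInt_expint_1_0_opp].
Qed.

(** Here (cosh y - 1)/y is the odd part (h(y) - h(-y))/2 of h(y) = (e^y - 1)/y. *)
Lemma Chi_RtoC (clog : C -> C) (x : R) :
  x <> 0 ->
  Chi clog x = (Euler_gamma + clog x + RtoC (x * (expint 2 0 x - expint 2 0 (- x)) / 2))%C.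
Proof.
  intros Hx; unfold Chi; f_equal.
  apply C_int0_RtoC with (g := fun y => (expint 1 0 y - expint 1 0 (- y)) / 2).
  - intros u Hu; set (y := u * x).
    assert (Hy : y <> 0) by (apply Rmult_integral_contrapositive; lra).
    unfold Ccosh; rewrite <- RtoC_opp, !Cexp_RtoC, <- RtoC_plus.
    rewrite <- (RtoC_div _ 2) by lra.
    rewrite <- RtoC_minus, <- RtoC_div by exact Hy; f_equal.
    pose proof (expint_1_0 y) as H1; pose proof (expint_1_0 (- y)) as H2.
    apply Rmult_eq_reg_l with y; [|exact Hy].
    field_simplify; [|exact Hy]; lra.
  - apply is_RInt_ext with
      (f := fun u => scal (/ 2) (minus (expint 1 0 (u * x) * x) (expint 1 0 (- (u * x)) * x))).
    + intros u _; unfold scal, minus, plus, opp; simpl; unfold mult; simpl; field.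
    + replace (x * _ / 2) with
        (scal (/ 2) (minus (x * expint 2 0 x) (x * expint 2 0 (- x))))
        by (unfold scal, minus, plus, opp; simpl; unfold mult; simpl; field).
      apply (is_RInt_scal (V := R_NormedModule)), (is_RInt_minus (V := R_NormedModule));
        [apply is_RInt_expint_1_0|apply is_RInt_expint_1_0_opp].
Qed.

(** The same value of the logarithm occurs in the bracket and in Chi, so it cancels, as does Euler's
    constant. The even and odd parts then add up to x [expint 2 0] x. *)
Lemma bracket_RtoC (clog : C -> C) (x : R) :
  x <> 0 -> bracket clog x = RtoC (- expint 2 0 x).
Proof.
  intros Hx; unfold bracket; rewrite Chi_RtoC, Shi_RtoC by exact Hx.
  transitivity (RtoC (- (x * expint 2 0 x)) / x)%C.
  - f_equal.
    replace (- (x * expint 2 0 x)) with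
      (- (x * (expint 2 0 x - expint 2 0 (- x)) / 2)
       - x * (expint 2 0 x + expint 2 0 (- x)) / 2) by field.
    rewrite RtoC_minus, RtoC_opp; ring.
  - rewrite <- RtoC_div by exact Hx; f_equal; field; exact Hx.
Qed.

Lemma bracket_ext_RtoC (clog : C -> C) (x : R) :
  bracket_ext clog x = RtoC (- expint 2 0 x).
Proof.
  unfold bracket_ext; destruct (Ceq_dec x 0) as [Hx|Hx].
  (* At 0 the extension is a limit, computed by continuity of [expint 2 0]. *)
  - apply RtoC_inj in Hx; subst x.
    apply C_lim_RtoC with (g := fun y => - expint 2 0 y).
    + intros y Hy; apply bracket_RtoC, Hy.
    + apply (is_lim_continuity (fun y => - expint 2 0 y)), continuity_pt_filterlim.
      apply (continuous_opp (V := R_NormedModule)), continuous_expint.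
  - apply bracket_RtoC; intros ->; now apply Hx.
Qed.

Lemma C_derive_n_bracket_ext (clog : C -> C) (n : nat) (x : R) :
  C_derive_n (bracket_ext clog) n x = RtoC (- expint 2 n x).
Proof.
  revert x; induction n as [|n IHn]; intros x.
  - apply bracket_ext_RtoC.
  - apply C_derive_RtoC with (g := fun y => - expint 2 n y); [exact IHn|].
    apply (is_derive_opp (V := R_NormedModule)), is_derive_expint.
Qed.

Lemma RtoC_sum_n (a : nat -> R) (n : nat) :
  sum_n (fun k => RtoC (a k)) n = RtoC (sum_n a n).
Proof.
  induction n as [|n IHn]; [now rewrite !sum_O|].
  rewrite !sum_Sn, IHn; symmetry; apply RtoC_plus.
Qed.

Lemma calF_RtoC (clog : C -> C) (s k : Z) (x : R) :
  (0 <= k)%Z -> (s <= k)%Z ->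
  calF clog s k x =
  RtoC (sum_n (fun n => (-1) ^ n * Binomial.C (Z.to_nat k) n
                        * - expint 2 (n + Z.to_nat (k - s)) x) (Z.to_nat k)).
Proof.
  intros Hk Hs; unfold calF; rewrite <- RtoC_sum_n.
  apply sum_n_ext; intros n.
  rewrite C_derive_n_bracket_ext, <- RtoC_mult.
  now replace (Z.to_nat (Z.of_nat n + k - s)) with (n + Z.to_nat (k - s))%nat by lia.
Qed.

(** * Limits of sums and products, and t ln t near 0 *)

Lemma filterlim_Rplus {F : (R -> Prop) -> Prop} {FF : Filter F} (f g : R -> R) (a b : R) :
  filterlim f F (locally a) -> filterlim g F (locally b) ->
  filterlim (fun t => f t + g t) F (locally (a + b)).
Proof.
  intros Hf Hg; eapply filterlim_comp_2; [exact Hf|exact Hg|].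
  apply (filterlim_plus (V := R_NormedModule)).
Qed.

Lemma filterlim_Rmult {F : (R -> Prop) -> Prop} {FF : Filter F} (f g : R -> R) (a b : R) :
  filterlim f F (locally a) -> filterlim g F (locally b) ->
  filterlim (fun t => f t * g t) F (locally (a * b)).
Proof.
  intros Hf Hg; eapply filterlim_comp_2; [exact Hf|exact Hg|].
  apply (filterlim_mult (K := R_AbsRing)).
Qed.

Lemma filterlim_Ropp {F : (R -> Prop) -> Prop} (f : R -> R) (a : R) :
  filterlim f F (locally a) -> filterlim (fun t => - f t) F (locally (- a)).
Proof.
  intros Hf; eapply filterlim_comp; [exact Hf|].
  apply (filterlim_opp (V := R_NormedModule)).
Qed.

Lemma filterlim_x_ln_x : filterlim (fun t => t * ln t) (at_right 0) (locally 0).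
Proof.
  (* The substitution y = 1/t reduces the claim to ln y / y tending to 0 at infinity. *)
  apply filterlim_ext_loc with (f := fun t => - (ln (/ t) / / t)).
  - exists (mkposreal 1 Rlt_0_1); intros t _ Ht.
    rewrite ln_Rinv by exact Ht; field; lra.
  - replace 0 with (- 0) at 2 by ring.
    apply filterlim_Ropp.
    apply (filterlim_comp _ _ _ Rinv (fun y => ln y / y) _ (Rbar_locally p_infty)).
    + apply filterlim_Rinv_0_right.
    + apply is_lim_div_ln_p.
Qed.

(** * A primitive of t^j e^(x t) ln t and its boundary values *)

Definition exp_ln_prim (j : nat) (x t : R) : R :=
  ln t * (t ^ S j * expint 1 j (x * t)) - t ^ S j * expint 2 j (x * t).

(** Integration by parts: t^(j+1) [expint 1 j] (x t) is a primitive of t^j e^(x t), and the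
    subtracted term is a primitive of its quotient by t. *)
Lemma is_derive_exp_ln_prim (j : nat) (x t : R) :
  0 < t -> is_derive (exp_ln_prim j x) t (t ^ j * (exp (x * t) * ln t)).
Proof.
  intros Ht.
  replace (t ^ j * (exp (x * t) * ln t)) with
    (/ t * (t ^ S j * expint 1 j (x * t)) + ln t * (t ^ j * expint 0 j (x * t))
     - t ^ j * expint 1 j (x * t))
    by (rewrite expint_0; simpl pow; field; lra).
  apply (is_derive_minus (V := R_NormedModule)); [|apply is_derive_pow_expint].
  apply (is_derive_mult ln (fun t => t ^ S j * expint 1 j (x * t))).
  - apply is_derive_ln, Ht.
  - apply is_derive_pow_expint.
  - intros; apply Rmult_comm.
Qed.

(** The logarithm vanishes at 1; what remains is the j-th derivative of the bracket at [x]. *)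
Lemma exp_ln_prim_1 (j : nat) (x : R) : exp_ln_prim j x 1 = - expint 2 j x.
Proof. unfold exp_ln_prim; rewrite ln_1, pow1, Rmult_1_r; ring. Qed.

Lemma continuous_scaled_expint (p j : nat) (x t : R) :
  continuous (fun t => expint p j (x * t)) t.
Proof.
  apply (continuous_comp (fun t => x * t)); [|apply continuous_expint].
  apply (continuous_scal_r (V := R_NormedModule) x (fun t => t)), continuous_id.
Qed.

Lemma exp_ln_prim_lim_0 (j : nat) (x : R) :
  filterlim (exp_ln_prim j x) (at_right 0) (locally 0).
Proof.
  set (a := fun t => t ^ j * expint 1 j (x * t)).
  set (b := fun t => t ^ S j * expint 2 j (x * t)).
  assert (Ha : continuous a 0).
  { apply (continuous_mult (fun t => t ^ j)); [|apply continuous_scaled_expint].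
    apply (ex_derive_continuous (V := R_NormedModule)); auto_derive; exact I. }
  assert (Hb : continuous b 0).
  { apply (ex_derive_continuous (V := R_NormedModule)).
    eexists; apply is_derive_pow_expint. }
  (* One factor of t^(j+1) is spent on taming ln t; the other factors are continuous at 0. *)
  apply filterlim_ext with (f := fun t => t * ln t * a t + - b t).
  { intros t; unfold a, b, exp_ln_prim; simpl; ring. }
  replace 0 with (0 * a 0 + - b 0) at 2 by (unfold b; simpl; ring).
  assert (Hle : filter_le (at_right 0) (locally 0)) by apply filter_le_within.
  apply filterlim_Rplus.
  - apply filterlim_Rmult; [apply filterlim_x_ln_x|].
    exact (filterlim_filter_le_1 _ Hle Ha).
  - apply filterlim_Ropp; exact (filterlim_filter_le_1 _ Hle Hb).
Qed.

(** * Binomial expansion of the factor (1 - t)^k *)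

Lemma pow_1_minus (t : R) (k : nat) :
  (1 - t) ^ k = sum_n (fun n => (-1) ^ n * Binomial.C k n * t ^ n) k.
Proof.
  rewrite sum_n_Reals; replace (1 - t) with (-1 * t + 1) by ring.
  rewrite binomial; apply sum_eq; intros n _.
  rewrite pow1, Rpow_mult_distr; ring.
Qed.

(** The signed binomial weights are those of [calF], so that the value at t = 1 is a value of
    [calF]. *)
Definition beta_exp_ln_prim (k j : nat) (x t : R) : R :=
  sum_n (fun n => (-1) ^ n * Binomial.C k n * exp_ln_prim (n + j) x t) k.

Lemma is_derive_beta_exp_ln_prim (k j : nat) (x t : R) :
  0 < t ->
  is_derive (beta_exp_ln_prim k j x) t (t ^ j * (1 - t) ^ k * (exp (x * t) * ln t)).
Proof.
  intros Ht.
  replace (t ^ j * (1 - t) ^ k * (exp (x * t) * ln t)) with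
    (sum_n (fun n => (-1) ^ n * Binomial.C k n * (t ^ (n + j) * (exp (x * t) * ln t))) k).
  - apply (is_derive_sum_n (K := R_AbsRing) (V := R_NormedModule)); intros n _.
    apply is_derive_scal, is_derive_exp_ln_prim, Ht.
  - rewrite pow_1_minus.
    rewrite (Rmult_comm (t ^ j)), Rmult_assoc.
    etransitivity; [|apply (sum_n_mult_r (K := R_Ring))].
    apply sum_n_ext; intros n; rewrite pow_add; unfold mult; simpl; ring.
Qed.

Lemma beta_exp_ln_prim_1 (k j : nat) (x : R) :
  beta_exp_ln_prim k j x 1 =
  sum_n (fun n => (-1) ^ n * Binomial.C k n * - expint 2 (n + j) x) k.
Proof. apply sum_n_ext; intros n; rewrite exp_ln_prim_1; reflexivity. Qed.

Lemma beta_exp_ln_prim_lim_0 (k j : nat) (x : R) :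
  filterlim (beta_exp_ln_prim k j x) (at_right 0) (locally 0).
Proof.
  (* The binomial weights depend on [k], so the induction on the length of the sum needs arbitrary
     coefficients. *)
  enough (H : forall c : nat -> R,
    filterlim (fun t => sum_n (fun n => c n * exp_ln_prim (n + j) x t) k)
      (at_right 0) (locally 0)) by apply H.
  intros c; induction k as [|k IHk].
  - apply filterlim_ext with (f := fun t => c O * exp_ln_prim j x t).
    { intros t; now rewrite sum_O. }
    replace 0 with (c O * 0) at 2 by ring.
    apply filterlim_Rmult; [apply filterlim_const|apply exp_ln_prim_lim_0].
  - apply filterlim_ext with
      (f := fun t => sum_n (fun n => c n * exp_ln_prim (n + j) x t) k
                     + c (S k) * exp_ln_prim (S k + j) x t).
    { intros t; now rewrite sum_Sn. }
    replace 0 with (0 + c (S k) * 0) at 2 by ring.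
    apply filterlim_Rplus; [exact IHk|].
    apply filterlim_Rmult; [apply filterlim_const|apply exp_ln_prim_lim_0].
Qed.

(** * Improper integrals from one-sided limits of a primitive *)

Lemma filterlim_1_minus_at_left : filterlim (fun t => 1 - t) (at_left 1) (at_right 0).
Proof.
  intros P [d Hd]; exists d; intros t Ht Ht1; apply Hd; [|lra].
  revert Ht; unfold ball; simpl; unfold AbsRing_ball, abs, minus, plus, opp; simpl.
  intros Ht; replace (1 - t + - 0) with (- (t + - 1)) by ring.
  now rewrite Rabs_Ropp.
Qed.

(** Lets pointwise facts known only on the open interval be used for integrals whose limits approach
    its ends. *)
Lemma filter_prod_at_right_at_left (a b : R) :
  a < b ->
  filter_prod (at_right a) (at_left b) (fun ab => forall t,
    Rmin (fst ab) (snd ab) <= t <= Rmax (fst ab) (snd ab) -> a < t < b).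
Proof.
  intros Hab; assert (Hd : 0 < b - a) by lra.
  apply Filter_prod with (fun u => a < u < b) (fun u => a < u < b).
  (* A point within b - a of one end, on the inner side, has not reached the other end. *)
  - exists (mkposreal _ Hd); intros u Hu Hau; split; [exact Hau|].
    apply Rabs_def2 in Hu; unfold minus, plus, opp in Hu; simpl in Hu; lra.
  - exists (mkposreal _ Hd); intros u Hu Hub; split; [|exact Hub].
    apply Rabs_def2 in Hu; unfold minus, plus, opp in Hu; simpl in Hu; lra.
  - intros u v Hu Hv t [H1 H2]; simpl in H1, H2; split.
    + eapply Rlt_le_trans; [|exact H1]; apply Rmin_glb_lt; lra.
    + eapply Rle_lt_trans; [exact H2|]; apply Rmax_lub_lt; lra.
Qed.

Lemma is_RInt_gen_primitive (F f : R -> R) (a b la lb : R) :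
  a < b ->
  (forall t, a < t < b -> is_derive F t (f t)) ->
  (forall t, a < t < b -> continuous f t) ->
  filterlim F (at_right a) (locally la) -> filterlim F (at_left b) (locally lb) ->
  is_RInt_gen f (at_right a) (at_left b) (lb - la).
Proof.
  intros Hab HF Hf Ha Hb.
  pose proof (filter_prod_at_right_at_left a b Hab) as Hin.
  apply is_RInt_gen_ext with (f := Derive F).
  { revert Hin; apply filter_imp; intros ab Hin t Ht.
    apply is_derive_unique, HF, Hin; lra. }
  apply is_RInt_gen_Derive; try assumption.
  - revert Hin; apply filter_imp; intros ab Hin t Ht.
    eexists; apply HF, Hin, Ht.
  - revert Hin; apply filter_imp; intros ab Hin t Ht.
    specialize (Hin t Ht).
    (* [Derive F] and [f] agree only on the open interval, so continuity is transferred through a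
       neighbourhood inside it. *)
    apply continuous_ext_loc with f; [|apply Hf, Hin].
    assert (Hopen : locally t (fun u => a < u < b)).
    { apply (open_and (fun u => a < u) (fun u => u < b));
        [apply open_gt|apply open_lt|exact Hin]. }
    revert Hopen; apply filter_imp; intros u Hu.
    symmetry; apply is_derive_unique, HF, Hu.
Qed.

(** * The primitive for the whole integrand and the final identity *)

(** The second term treats ln (1 - t) through e^(x t) = e^x e^(-x (1 - t)); its minus sign offsets
    the derivative -1 of 1 - t, and the exponents [m] and [j] trade places. *)
Definition J1_prim (m j : nat) (x t : R) : R :=
  beta_exp_ln_prim m j x t - exp x * beta_exp_ln_prim j m (- x) (1 - t).

Lemma J1_integrand_pow (l m : Z) (x t : R) :
  (0 <= m)%Z -> (l <= m)%Z -> 0 < t < 1 ->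
  J1_integrand (IZR l / 2) (IZR m + (1 - IZR l) / 2) x t =
  exp (x * t) * t ^ Z.to_nat (m - l) * (1 - t) ^ Z.to_nat m * (ln t + ln (1 - t)).
Proof.
  intros Hm Hl Ht; unfold J1_integrand.
  rewrite ln_mult, <- !Rpower_pow, !INR_IZR_INZ, !Z2Nat.id, minus_IZR by lia || lra.
  replace (IZR m + (1 - IZR l) / 2 - IZR l / 2 - 1 / 2) with (IZR m - IZR l) by field.
  replace (IZR m + (1 - IZR l) / 2 + IZR l / 2 - 1 / 2) with (IZR m) by field.
  reflexivity.
Qed.

Lemma is_derive_J1_prim (m j : nat) (x t : R) :
  0 < t < 1 ->
  is_derive (J1_prim m j x) t
    (exp (x * t) * t ^ j * (1 - t) ^ m * (ln t + ln (1 - t))).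
Proof.
  intros Ht.
  assert (Hexp : exp (x * t) = exp x * exp (- x * (1 - t)))
    by (rewrite <- exp_plus; f_equal; ring).
  replace (exp (x * t) * t ^ j * (1 - t) ^ m * (ln t + ln (1 - t))) with
    (t ^ j * (1 - t) ^ m * (exp (x * t) * ln t)
     - exp x * (-1 * ((1 - t) ^ m * (1 - (1 - t)) ^ j * (exp (- x * (1 - t)) * ln (1 - t)))))
    by (rewrite Hexp; replace (1 - (1 - t)) with t by ring; ring).
  apply (is_derive_minus (V := R_NormedModule)).
  - apply is_derive_beta_exp_ln_prim; lra.
  - apply is_derive_scal.
    apply (is_derive_comp (beta_exp_ln_prim j m (- x)) (fun t => 1 - t)).
    + apply is_derive_beta_exp_ln_prim; lra.
    + auto_derive; [exact I|ring].
Qed.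

(** Each half of [J1_prim] contributes at one end only: the first vanishes at t = 0, the second at t
    = 1. *)
Lemma is_RInt_gen_J1 (m j : nat) (x : R) :
  is_RInt_gen (fun t => exp (x * t) * t ^ j * (1 - t) ^ m * (ln t + ln (1 - t)))
    (at_right 0) (at_left 1)
    (beta_exp_ln_prim m j x 1 + exp x * beta_exp_ln_prim j m (- x) 1).
Proof.
  assert (Hcont : forall k j x, continuous (beta_exp_ln_prim k j x) 1).
  { intros; apply (ex_derive_continuous (V := R_NormedModule)).
    eexists; apply is_derive_beta_exp_ln_prim; lra. }
  (* Written as the limit at 1 minus the limit at 0, in the form the limit lemmas produce. *)
  replace (_ + _) with
    (beta_exp_ln_prim m j x 1 + - (exp x * 0)
     - (0 + - (exp x * beta_exp_ln_prim j m (- x) 1))) by ring.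
  apply is_RInt_gen_primitive with (J1_prim m j x).
  - lra.
  - intros; now apply is_derive_J1_prim.
  - intros; apply (ex_derive_continuous (V := R_NormedModule)); auto_derive; lra.
  - apply filterlim_Rplus; [apply beta_exp_ln_prim_lim_0|].
    apply filterlim_Ropp, filterlim_Rmult; [apply filterlim_const|].
    apply (filterlim_filter_le_1 (F := locally 0)); [apply filter_le_within|].
    apply (filterlim_comp _ _ _ (fun t => 1 - t) (beta_exp_ln_prim j m (- x)) _ (locally 1)).
    + assert (Hsub : continuous (fun t => 1 - t) 0).
      { apply (ex_derive_continuous (V := R_NormedModule)); auto_derive; exact I. }
      unfold continuous in Hsub; now rewrite Rminus_0_r in Hsub.
    + apply Hcont.
  - apply filterlim_Rplus.
    + apply (filterlim_filter_le_1 (F := locally 1)); [apply filter_le_within|apply Hcont].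
    + apply filterlim_Ropp, filterlim_Rmult; [apply filterlim_const|].
      apply (filterlim_comp _ _ _ (fun t => 1 - t) (beta_exp_ln_prim j m (- x)) _ (at_right 0)).
      * apply filterlim_1_minus_at_left.
      * apply beta_exp_ln_prim_lim_0.
Qed.

Theorem theorem23 :
  forall clog : C -> C, is_clog clog ->
  forall (l m : Z), (0 <= m)%Z -> (l <= m)%Z ->
  forall x : R,
    J1_converges (IZR l / 2) (IZR m + (1 - IZR l) / 2) x /\
    RtoC (J1 (IZR l / 2) (IZR m + (1 - IZR l) / 2) x)
    = (Cexp x * calF clog (- l) (m - l) (- x) + calF clog l m x)%C.
Proof.
  intros clog _ l m Hm Hl x.
  pose proof (is_RInt_gen_J1 (Z.to_nat m) (Z.to_nat (m - l)) x) as HI.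
  apply is_RInt_gen_ext with (g := J1_integrand (IZR l / 2) (IZR m + (1 - IZR l) / 2) x) in HI.
  - split; [eexists; exact HI|].
    unfold J1; rewrite (is_RInt_gen_unique _ _ HI), !beta_exp_ln_prim_1.
    rewrite <- RtoC_opp, Cexp_RtoC, !calF_RtoC by lia.
    (* In the reflected term k - s = (m - l) - (-l) = m, so the lowest derivative order there is the
       exponent of 1 - t. *)
    replace (m - l - - l)%Z with m by ring.
    rewrite <- RtoC_mult, <- RtoC_plus; f_equal; apply Rplus_comm.
  - generalize (filter_prod_at_right_at_left 0 1 Rlt_0_1).
    apply filter_imp; intros ab Hab t Ht.
    symmetry; apply J1_integrand_pow; try assumption; apply Hab; lra.
Qed.
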